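(* Let $r$ be continuous, let $f$ be a nontrivial real solution of $f''(x)+r(x)f(x)=0$, let $z_{f'_1}<z_{f'_2}$ be two consecutive zeros of $f'$, let $\mathcal{I}=(z_{f'_1},z_{f'_2})$, and let $z_{f_1}$ be the unique zero of $f$ in $\mathcal{I}$. Put $h=f/f'$ on $\mathcal I$. Let $c_1$ and $c_2$ be positive constants such that $c_2<r(x)<c_1$ for all $x\in\mathcal I$ and $\frac{c_1}{c_2}\le\frac32$. Then for every initial guess $x_0\in\mathcal I$ the sequence defined by $$x_{n+1}=x_n-\frac{2h(x_n)}{2+r(x_0)h^2(x_n)},\qquad n=0,1,2,\dots$$ is well defined and converges monotonically to $z_{f_1}$.
   Context: All functions are real-valued; $r$ is continuous on an open interval $D\subseteq\mathbb{R}$ containing all points mentioned, and $f$ is a not identically zero solution on $D$ of $f''+rf=0$. It is a standing assumption that $f$ has exactly one zero $z_{f_1}$ in $\mathcal I=(z_{f'_1},z_{f'_2})$. Since $f'$ has no zeros in $\mathcal I$, the function $h=f/f'$ is defined on $\mathcal I$. ''Converges monotonically'' means that the sequence is (weakly) monotone and converges; if $x_0=z_{f_1}$ the sequence is constant. *)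

(* Defs.v *)
From Stdlib Require Import Reals.
From Coquelicot Require Import Coquelicot.
Open Scope R_scope.

Definition in_open (a b : Rbar) (x : R) : Prop := Rbar_lt a x /\ Rbar_lt x b.

(* [Derive] is total, so the existence of both derivatives is required
   explicitly. *)
Definition is_solution (a b : Rbar) (r f : R -> R) : Prop :=
  forall x, in_open a b x ->
    ex_derive f x /\ ex_derive (Derive f) x /\
    Derive (Derive f) x + r x * f x = 0.

Definition consecutive_zeros (g : R -> R) (u v : R) : Prop :=
  u < v /\ g u = 0 /\ g v = 0 /\ forall x, u < x < v -> g x <> 0.

Definition h (f : R -> R) (x : R) : R := f x / Derive f x.

(* The coefficient [r x0] is frozen at the initial guess. *)
Fixpoint iter_seq (r f : R -> R) (x0 : R) (n : nat) : R :=
  match n with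
  | O => x0
  | S m => let x := iter_seq r f x0 m in
           x - 2 * h f x / (2 + r x0 * (h f x) ^ 2)
  end.

(* Division is total: well-definedness says that every iterate lies in the
   domain (u, v) of h and that no division by zero ever occurs. *)
Definition iter_well_defined (r f : R -> R) (u v x0 : R) : Prop :=
  forall n, let x := iter_seq r f x0 n in
    u < x < v /\ Derive f x <> 0 /\ 2 + r x0 * (h f x) ^ 2 <> 0.

Definition converges_monotonically (x : nat -> R) (l : R) : Prop :=
  ((forall n, x n <= x (S n)) \/ (forall n, x (S n) <= x n)) /\
  is_lim_seq x l.

(* Main.v *)
(** With [h' = 1 + r h^2], the iteration map [G = x - 2h / (2 + rho h^2)],
    [rho = r x0], has derivative
    [G' = 1 - 2 (2 - rho h^2) (1 + r h^2) / (2 + rho h^2)^2].  The ratio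
    hypothesis gives [r < 3/2 rho], and
    [(2 + t)^2 - 2 (2 - t) (1 + 3/2 t) = 4 t^2] with [t = rho h^2], so [G' >= 0].
    Hence [G] never crosses its fixed point [z], while [G x - x] has the sign of
    [-h x], that is of [z - x]: the iterates move monotonically towards [z], and
    their limit is a zero of [h]. *)

Require Import Defs.
From Stdlib Require Import Reals Lra.
From Coquelicot Require Import Coquelicot.
Open Scope R_scope.

Lemma in_open_convex (a b : Rbar) (u v x : R) :
  in_open a b u -> in_open a b v -> u < x < v -> in_open a b x.
Proof.
  intros [Hau _] [_ Hvb] [Hux Hxv]; split.
  - now apply Rbar_lt_trans with (2 := Hux : Rbar_lt u x).
  - now apply Rbar_lt_trans with (1 := Hxv : Rbar_lt x v).
Qed.

(** The quotient rule gives [1 - f f'' / f'^2], and the equation replaces [f''] by [- r f]: this is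
    the Riccati equation for [h]. *)
Lemma is_derive_h (a b : Rbar) (r f : R -> R) (x : R) :
  is_solution a b r f -> in_open a b x -> Derive f x <> 0 ->
  is_derive (h f) x (1 + r x * h f x ^ 2).
Proof.
  intros Hsol Hx Hf'.
  destruct (Hsol x Hx) as [Df [Df' Heq]].
  replace (1 + r x * h f x ^ 2) with
    ((Derive f x * Derive f x - f x * Derive (Derive f) x) / Derive f x ^ 2).
  - apply is_derive_div; trivial; now apply Derive_correct.
  - replace (Derive (Derive f) x) with (- (r x * f x)) by lra.
    unfold h; field; assumption.
Qed.

(** Keeping [rho] as a constant parameter means that differentiating in [x] never calls for a
    derivative of [r], which is only continuous. *)
Definition step (f : R -> R) (rho x : R) : R :=
  x - 2 * h f x / (2 + rho * h f x ^ 2).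

Lemma step_denominator_pos (rho y : R) : 0 < rho -> 0 < 2 + rho * y ^ 2.
Proof. intros Hrho; pose proof (pow2_ge_0 y); nra. Qed.

Lemma is_derive_step (f : R -> R) (rho x d : R) :
  0 < rho -> is_derive (h f) x d ->
  is_derive (step f rho) x
    (1 - 2 * (2 - rho * h f x ^ 2) * d / (2 + rho * h f x ^ 2) ^ 2).
Proof.
  intros Hrho Hd.
  pose proof (step_denominator_pos rho (h f x) Hrho) as Hpos.
  unfold step.
  auto_derive.
  - repeat split; [now exists d | now exists d | simpl in Hpos; lra].
  - replace (Derive (fun x => h f x) x) with d
      by (symmetry; now apply is_derive_unique).
    field; simpl in Hpos |- *; lra.
Qed.

Lemma step_derivative_nonneg (rho rx y : R) :
  0 < rho -> 0 <= rx <= 3 / 2 * rho ->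
  0 <= 1 - 2 * (2 - rho * y ^ 2) * (1 + rx * y ^ 2) / (2 + rho * y ^ 2) ^ 2.
Proof.
  intros Hrho Hrx.
  pose proof (step_denominator_pos rho y Hrho) as Hpos.
  pose proof (pow2_ge_0 y) as Hy.
  replace (1 - _) with
    (((2 + rho * y ^ 2) ^ 2 - 2 * (2 - rho * y ^ 2) * (1 + rx * y ^ 2))
     / (2 + rho * y ^ 2) ^ 2) by (field; lra).
  apply Rdiv_le_0_compat; [| now apply pow_lt].
  set (s := y ^ 2) in *.
  assert (0 <= rho * s) by nra.
  assert (0 <= rx * s <= 3 / 2 * (rho * s)) by nra.
  (* With [t = rho * s]: if [t <= 2], the factor [2 - t] is nonnegative, so [rx * s] may be replaced
     by its upper bound [3/2 t], which leaves [4 t^2]. If [t > 2], the subtracted product is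
     negative. *)
  destruct (Rle_dec (rho * s) 2); nra.
Qed.

(** A weak criterion is needed because the derivative of [step] vanishes where [h] does, so the
    strict [incr_function] cannot be applied to it. *)
Lemma derive_nonneg_le (g dg : R -> R) (x y : R) :
  (forall t, x <= t <= y -> is_derive g t (dg t)) ->
  (forall t, x <= t <= y -> 0 <= dg t) ->
  x <= y -> g x <= g y.
Proof.
  intros Hd Hpos Hxy.
  destruct (MVT_gen g x y dg) as [t [Ht Heq]];
    rewrite ?(Rmin_left x y), ?(Rmax_right x y) in * by exact Hxy.
  - intros t Ht; apply Hd; lra.
  - intros t Ht; apply continuity_pt_filterlim, @ex_derive_continuous.
    now exists (dg t); apply Hd.
  - specialize (Hpos t Ht); nra.
Qed.

(** The closed bounds [p] and [q] pass to the limit [l], so [G] is continuous at [l]. Letting [n]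
    tend to infinity in the recurrence gives [G l = l]. *)
Lemma monotone_iteration_limit (G : R -> R) (x : nat -> R) (p q z : R) :
  (forall n, x (S n) = G (x n)) ->
  (forall n, p <= x n <= q) ->
  (forall t, p <= t <= q -> continuous G t) ->
  (forall t, p <= t <= q -> G t = t -> t = z) ->
  (forall n, x n <= x (S n)) \/ (forall n, x (S n) <= x n) ->
  converges_monotonically x z.
Proof.
  intros HG Hpq Hcont Hfix Hmon; split; [exact Hmon |].
  assert (Hex : ex_finite_lim_seq x).
  { destruct Hmon as [Hincr | Hdecr].
    - apply ex_finite_lim_seq_incr with q; [exact Hincr | apply Hpq].
    - apply ex_finite_lim_seq_decr with p; [exact Hdecr | apply Hpq]. }
  destruct Hex as [l Hl].
  assert (Hp : p <= l).
  { apply (is_lim_seq_le (fun _ => p) x p l); trivial; [apply Hpq |].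
    apply is_lim_seq_const. }
  assert (Hq : l <= q).
  { apply (is_lim_seq_le x (fun _ => q) l q); trivial; [apply Hpq |].
    apply is_lim_seq_const. }
  replace z with l; [exact Hl |].
  apply Hfix; [now split |].
  assert (H1 : is_lim_seq (fun n => G (x n)) (G l)).
  { apply is_lim_seq_continuous; [| exact Hl].
    now apply continuity_pt_filterlim, Hcont. }
  assert (H2 : is_lim_seq (fun n => G (x n)) l).
  { apply is_lim_seq_ext with (fun n => x (S n)); [exact HG |].
    now apply -> is_lim_seq_incr_1. }
  apply is_lim_seq_unique in H1; apply is_lim_seq_unique in H2.
  congruence.
Qed.

Theorem theorem3p5 (a b : Rbar) (r f : R -> R) (z'1 z'2 z c1 c2 : R)
  (r_cont : forall x, in_open a b x -> continuous r x)
  (f_sol : is_solution a b r f)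
  (f_nontrivial : exists x, in_open a b x /\ f x <> 0)
  (z'1_in : in_open a b z'1)
  (z'2_in : in_open a b z'2)
  (z'_consecutive : consecutive_zeros (Derive f) z'1 z'2)
  (z_unique : unique (fun x => z'1 < x < z'2 /\ f x = 0) z)
  (c1_pos : 0 < c1)
  (c2_pos : 0 < c2)
  (r_bounds : forall x, z'1 < x < z'2 -> c2 < r x < c1)
  (c_ratio : c1 / c2 <= 3 / 2) :
  forall x0, z'1 < x0 < z'2 ->
    iter_well_defined r f z'1 z'2 x0 /\
    converges_monotonically (iter_seq r f x0) z.
Proof.
  intros x0 Hx0.
  destruct z'_consecutive as [_ [_ [_ Hf']]].
  destruct z_unique as [[Hz Hfz] _].
  assert (Hratio : c1 <= 3 / 2 * c2).
  { apply (Rmult_le_compat_r c2) in c_ratio; [| lra].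
    now replace (c1 / c2 * c2) with c1 in c_ratio by (field; lra). }
  set (rho := r x0).
  assert (Hrho : c2 < rho < c1) by now apply r_bounds.
  assert (Hrho0 : 0 < rho) by lra.
  assert (Hdh : forall x, z'1 < x < z'2 ->
            is_derive (h f) x (1 + r x * h f x ^ 2)).
  { intros x Hx; apply is_derive_h with a b; trivial; [| now apply Hf'].
    now apply in_open_convex with z'1 z'2. }
  assert (hz : h f z = 0) by (unfold h; rewrite Hfz; apply Rmult_0_l).
  (* Since [r > c2 > 0], the derivative [1 + r h^2] is at least 1. *)
  assert (h_incr : forall x y, z'1 < x -> x < y -> y < z'2 -> h f x < h f y).
  { apply (incr_function (h f) z'1 z'2 (fun x => 1 + r x * h f x ^ 2)).
    - intros x H1 H2; now apply Hdh.
    - intros x H1 H2; pose proof (r_bounds x (conj H1 H2)).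
      pose proof (pow2_ge_0 (h f x)); nra. }
  set (G := step f rho).
  assert (HdG : forall x, z'1 < x < z'2 -> is_derive G x
    (1 - 2 * (2 - rho * h f x ^ 2) * (1 + r x * h f x ^ 2)
         / (2 + rho * h f x ^ 2) ^ 2)).
  { intros x Hx; now apply is_derive_step, Hdh. }
  assert (G_incr : forall x y, z'1 < x -> x <= y -> y < z'2 -> G x <= G y).
  { intros x y H1 Hxy H2.
    eapply derive_nonneg_le; [| | exact Hxy].
    - intros t Ht; apply HdG; lra.
    - intros t Ht; assert (Ht' : z'1 < t < z'2) by lra.
      (* The chain [r t < c1 <= 3/2 c2 < 3/2 rho] holds whatever the initial guess. *)
      specialize (r_bounds t Ht'); apply step_derivative_nonneg; lra. }
  assert (Gz : G z = z).
  { unfold G, step; rewrite hz; field; lra. }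
  (* Hiding the positive factor in [k] reduces the later sign arguments to the sign of [h]. *)
  assert (G_shift : forall x, exists k, 0 < k /\ G x = x - k * h f x).
  { intros x; pose proof (step_denominator_pos rho (h f x) Hrho0).
    exists (2 / (2 + rho * h f x ^ 2)); split.
    - apply Rdiv_lt_0_compat; lra.
    - unfold G, step; field; lra. }
  assert (G_right : forall x, z <= x < z'2 -> z <= G x <= x).
  { intros x Hx; split.
    - rewrite <- Gz; apply G_incr; lra.
    - destruct (G_shift x) as [k [Hk ->]].
      destruct (Req_dec x z) as [-> | Hne]; [rewrite hz; lra |].
      assert (h f z < h f x) by (apply h_incr; lra); nra. }
  assert (G_left : forall x, z'1 < x <= z -> x <= G x <= z).
  { intros x Hx; split.
    - destruct (G_shift x) as [k [Hk ->]].
      destruct (Req_dec x z) as [-> | Hne]; [rewrite hz; lra |].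
      assert (h f x < h f z) by (apply h_incr; lra); nra.
    - rewrite <- Gz; apply G_incr; lra. }
  assert (G_fix : forall x, z'1 < x < z'2 -> G x = x -> x = z).
  { intros x Hx HGx; destruct (G_shift x) as [k [Hk Heq]].
    assert (h f x = 0) by nra.
    destruct (Rtotal_order x z) as [Hlt | [Heq' | Hgt]]; trivial.
    - assert (h f x < h f z) by (apply h_incr; lra); lra.
    - assert (h f z < h f x) by (apply h_incr; lra); lra. }
  set (x := iter_seq r f x0).
  assert (HS : forall n, x (S n) = G (x n)) by reflexivity.
  (* The interval between [x0] and [z] is invariant and compact inside the open interval, so the
     limit cannot escape to a zero of [f']. *)
  assert (Hinv : exists p q, z'1 < p /\ q < z'2 /\
            (forall n, p <= x n <= q) /\
            ((forall n, x n <= x (S n)) \/ (forall n, x (S n) <= x n))).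
  { destruct (Rle_dec x0 z) as [Hle | Hgt].
    - assert (Hb : forall n, x0 <= x n <= z).
      { induction n as [| n IH]; [change (x O) with x0; lra |].
        assert (x n <= G (x n) <= z) by (apply G_left; lra).
        rewrite HS; lra. }
      exists x0, z; repeat split; try lra; try apply Hb.
      left; intros n; specialize (Hb n).
      rewrite HS; apply G_left; lra.
    - assert (Hb : forall n, z <= x n <= x0).
      { induction n as [| n IH]; [change (x O) with x0; lra |].
        assert (z <= G (x n) <= x n) by (apply G_right; lra).
        rewrite HS; lra. }
      exists z, x0; repeat split; try lra; try apply Hb.
      right; intros n; specialize (Hb n).
      rewrite HS; apply G_right; lra. }
  destruct Hinv as [p [q [Hp [Hq [Hpq Hmon]]]]].
  split.
  - intros n; cbv zeta; change (iter_seq r f x0 n) with (x n).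
    assert (Hxn : z'1 < x n < z'2) by (specialize (Hpq n); lra).
    repeat split; try lra; [now apply Hf' |].
    now apply Rgt_not_eq, step_denominator_pos.
  - apply monotone_iteration_limit with G p q; trivial.
    + intros t Ht; apply @ex_derive_continuous.
      eexists; apply HdG; lra.
    + intros t Ht; apply G_fix; lra.
Qed.
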